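(* Let $r\ge1$, let $m_\bullet=(m_1,\ldots,m_r)$ be a sequence of integers with $m_i\ge1$ for all $i$, and let $n>M(m_\bullet)$. Then the maximal minors (that is, the $(M(m_\bullet)+1)\times(M(m_\bullet)+1)$ minors) of the $n\times(M(m_\bullet)+1)$ matrix $\mathcal{N}_{m_\bullet,n}(p_\bullet)$ form a universal Gröbner basis for the vanishing ideal of the Segre-determinantal locus $\operatorname{Seg}_{m_\bullet,n}$.
   Context: All varieties are complex algebraic varieties. For a finite sequence of integers $m_\bullet=(m_1,\ldots,m_r)$ with all $m_i\ge1$, put $\mathbb{P}^{m_\bullet}:=\mathbb{P}^{m_1}\times\cdots\times\mathbb{P}^{m_r}$ and $M(m_\bullet):=(m_1+1)\cdots(m_r+1)-1$. Let $\sigma_{m_\bullet}:\mathbb{P}^{m_\bullet}\to\mathbb{P}^{M(m_\bullet)}$ be the Segre embedding, sending $([p_{i,0}:\cdots:p_{i,m_i}])_{1\le i\le r}$ to the point whose homogeneous coordinates are all products $p_{1,\alpha^{(1)}}\cdots p_{r,\alpha^{(r)}}$ with $0\le\alpha^{(j)}\le m_j$. For $n\ge1$, the Segre-determinantal locus $\operatorname{Seg}_{m_\bullet,n}\subset(\mathbb{P}^{m_\bullet})^{\times n}$ is the smallest closed subvariety containing all $(P_1,\ldots,P_n)\in(\mathbb{P}^{m_\bullet})^{\times n}$ such that $\sigma_{m_\bullet}(P_1),\ldots,\sigma_{m_\bullet}(P_n)$ lie on some common hyperplane of $\mathbb{P}^{M(m_\bullet)}$. Let $R_{m_\bullet,n}=\mathbb{C}[p_{j,i}^{(k)}\mid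 1\le k\le n,\ 1\le j\le r,\ 0\le i\le m_j]$, the multihomogeneous coordinate ring of $(\mathbb{P}^{m_\bullet})^{\times n}$, where $p_{j,0}^{(k)},\ldots,p_{j,m_j}^{(k)}$ are the homogeneous coordinates on the $j$-th factor $\mathbb{P}^{m_j}$ of the $k$-th copy of $\mathbb{P}^{m_\bullet}$. Let $\mathcal{N}_{m_\bullet,n}(p_\bullet)$ be the $n\times(M(m_\bullet)+1)$ matrix over $R_{m_\bullet,n}$ with rows indexed by $k\in\{1,\ldots,n\}$ and columns indexed by $\alpha=(\alpha^{(1)},\ldots,\alpha^{(r)})$ with $0\le\alpha^{(j)}\le m_j$, whose $(k,\alpha)$ entry is $p_{1,\alpha^{(1)}}^{(k)}\cdots p_{r,\alpha^{(r)}}^{(k)}$. The vanishing ideal of a closed subvariety of $(\mathbb{P}^{m_\bullet})^{\times n}$ is the ideal of $R_{m_\bullet,n}$ generated by the multihomogeneous polynomials vanishing on it. A universal Gröbner basis of an ideal in a polynomial ring is a set of polynomials that is a Gröbner basis of the ideal with respect to every monomial order. *)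

(* Defs.v *)
From HB Require Import structures.
From mathcomp Require Import all_boot all_order all_algebra complex mpoly reals.

Set Implicit Arguments.
Unset Strict Implicit.
Unset Printing Implicit Defensive.

Import Order.TTheory GRing.Theory Num.Theory.
Local Open Scope ring_scope.

Definition in_ideal (K : fieldType) (N : nat)
    (S : {mpoly K[N]} -> Prop) (f : {mpoly K[N]}) : Prop :=
  exists s : seq ({mpoly K[N]} * {mpoly K[N]}),
    (forall q, q \in s -> S q.2) /\ f = \sum_(q <- s) q.1 * q.2.

(* 0 <= a for all a is, by Dickson's lemma, equivalent to well-foundedness for
   the orders below. *)
Definition monomial_order (N : nat) (le : rel 'X_{1..N}) : Prop :=
  [/\ reflexive le /\ antisymmetric le, transitive le, total le,
      (forall a : 'X_{1..N}, le 0%MM a)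
    & (forall a b c : 'X_{1..N}, le a b -> le (a + c)%MM (b + c)%MM)].

Definition is_lead_monomial (K : fieldType) (N : nat) (le : rel 'X_{1..N})
    (f : {mpoly K[N]}) (a : 'X_{1..N}) : Prop :=
  a \in msupp f /\ forall b, b \in msupp f -> le b a.

(* Since msupp 0 is empty, 0 contributes nothing to the initial ideal. *)
Definition in_initial_ideal (K : fieldType) (N : nat) (le : rel 'X_{1..N})
    (F : {mpoly K[N]} -> Prop) : {mpoly K[N]} -> Prop :=
  in_ideal (fun u => exists f a, [/\ F f, is_lead_monomial le f a & u = 'X_[a]]).

Definition groebner_basis (K : fieldType) (N : nat) (le : rel 'X_{1..N})
    (I : {mpoly K[N]} -> Prop) (G : seq {mpoly K[N]}) : Prop :=
  (forall g, g \in G -> I g) /\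
  (forall u, in_initial_ideal le (fun g => g \in G) u
             <-> in_initial_ideal le I u).

Definition universal_groebner_basis (K : fieldType) (N : nat)
    (I : {mpoly K[N]} -> Prop) (G : seq {mpoly K[N]}) : Prop :=
  forall le : rel 'X_{1..N}, monomial_order le -> groebner_basis le I G.

(* The point [v_0 : ... : v_d] is the line spanned by v. *)
Definition proj (K : fieldType) (d : nat) : Type :=
  {U : {vspace 'rV[K]_d.+1} | \dim U == 1%N}.

Definition has_coords (K : fieldType) (d : nat)
    (p : proj K d) (v : 'rV[K]_d.+1) : Prop := val p = <[v]>%VS.

Definition mproj (K : fieldType) (r : nat) (m : 'I_r -> nat) : Type :=
  forall j : 'I_r, proj K (m j).

Definition rep (K : fieldType) (d : nat) (p : proj K d) : 'rV[K]_d.+1 :=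
  vpick (val p).

Lemma vline_dim1 (K : fieldType) (vT : vectType K) (U : {vspace vT}) (v : vT) :
  \dim U == 1%N -> v != 0 -> v \in U -> U = <[v]>%VS.
Proof.
move=> /eqP dU v0 vU; apply/esym/eqP.
by rewrite eqEdim -memvE vU dU dim_vline v0.
Qed.

Lemma rep_neq0 (K : fieldType) (d : nat) (p : proj K d) : rep p != 0.
Proof. by rewrite vpick0 -dimv_eq0 (eqP (valP p)). Qed.

Lemma rep_coords (K : fieldType) (d : nat) (p : proj K d) :
  has_coords p (rep p).
Proof.
exact: (vline_dim1 (valP p) (rep_neq0 p) (memv_pick _)).
Qed.

Lemma coords_neq0 (K : fieldType) (d : nat) (p : proj K d) v :
  has_coords p v -> v != 0.
Proof.
move=> pv; have := valP p.
by rewrite pv dim_vline; case: (v != 0).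
Qed.

Definition midx (r : nat) (m : 'I_r -> nat) : finType :=
  {dffun forall j : 'I_r, 'I_(m j).+1}.

Definition Mseg (r : nat) (m : 'I_r -> nat) : nat :=
  (\prod_(j < r) (m j).+1 - 1)%N.

Lemma card_midx (r : nat) (m : 'I_r -> nat) : #|midx m| = (Mseg m).+1.
Proof.
rewrite /midx card_dep_ffun /Mseg subn1 prednK ?prodn_gt0 //.
rewrite foldrE big_map big_enum /=.
by apply: eq_bigr => j _; rewrite card_ord.
Qed.

(* Numbering of the coordinates of P^M by the multi-indices alpha. *)
Definition idx_of (r : nat) (m : 'I_r -> nat) (a : 'I_(Mseg m).+1) : midx m :=
  enum_val (cast_ord (esym (card_midx m)) a).

Definition segre_vec (K : fieldType) (r : nat) (m : 'I_r -> nat)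
    (v : forall j : 'I_r, 'rV[K]_(m j).+1) : 'rV[K]_(Mseg m).+1 :=
  \row_a \prod_(j < r) v j 0 (idx_of a j).

Lemma segre_vec_neq0 (K : fieldType) (r : nat) (m : 'I_r -> nat)
    (v : forall j : 'I_r, 'rV[K]_(m j).+1) :
  (forall j, v j != 0) -> segre_vec v != 0.
Proof.
move=> v0.
have h j : exists i, v j 0 i != 0 by apply/rV0Pn.
pose al : midx m := [ffun j => xchoose (h j)].
apply/rV0Pn; exists (cast_ord (card_midx m) (enum_rank al)).
rewrite mxE /idx_of cast_ordK enum_rankK.
by apply/prodf_neq0 => j _; rewrite ffunE; apply: (xchooseP (h j)).
Qed.

Lemma segre_dim (K : fieldType) (r : nat) (m : 'I_r -> nat) (P : mproj K m) :
  \dim <[segre_vec (fun j => rep (P j))]>%VS == 1%N.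
Proof. by rewrite dim_vline segre_vec_neq0 // => j; apply: rep_neq0. Qed.

Definition segre (K : fieldType) (r : nat) (m : 'I_r -> nat) (P : mproj K m) :
    proj K (Mseg m) :=
  exist _ <[segre_vec (fun j => rep (P j))]>%VS (segre_dim P).

(* The choice of representatives in segre is immaterial. *)
Lemma segreE (K : fieldType) (r : nat) (m : 'I_r -> nat) (P : mproj K m)
    (v : forall j : 'I_r, 'rV[K]_(m j).+1) :
  (forall j, has_coords (P j) (v j)) -> has_coords (segre P) (segre_vec v).
Proof.
move=> hv; have v0 : segre_vec v != 0.
  by apply: segre_vec_neq0 => j; apply: coords_neq0 (hv j).
apply: vline_dim1 => //=; first exact: segre_dim.
have h j : exists c, v j == c *: rep (P j).
  have /vlineP[c ->] : v j \in <[rep (P j)]>%VS.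
    by rewrite -(rep_coords (P j)) (hv j) memv_line.
  by exists c.
apply/vlineP; exists (\prod_j xchoose (h j)); apply/rowP => a.
rewrite !mxE -big_split /=; apply: eq_bigr => j _.
by rewrite {1}(eqP (xchooseP (h j))) mxE.
Qed.

(* The triple (k, j, i) stands for the variable p_{j,i}^{(k)}. *)
Definition pvar (n r : nat) (m : 'I_r -> nat) : finType :=
  ('I_n * {j : 'I_r & 'I_(m j).+1})%type.

Definition nvars (n r : nat) (m : 'I_r -> nat) : nat := #|pvar n m|.

Definition var_idx (n r : nat) (m : 'I_r -> nat)
    (k : 'I_n) (j : 'I_r) (i : 'I_(m j).+1) : 'I_(nvars n m) :=
  enum_rank ((k, Tagged (fun j => 'I_(m j).+1) i) : pvar n m).

Definition pX (K : fieldType) (n r : nat) (m : 'I_r -> nat)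
    (k : 'I_n) (j : 'I_r) (i : 'I_(m j).+1) : {mpoly K[nvars n m]} :=
  'X_(var_idx k i).

Definition multihomogeneous (K : fieldType) (n r : nat) (m : 'I_r -> nat)
    (f : {mpoly K[nvars n m]}) : Prop :=
  exists d : 'I_n -> 'I_r -> nat, forall a, a \in msupp f ->
    forall k j, (\sum_(i < (m j).+1) a (var_idx k i))%N = d k j.

Definition eval_coords (K : fieldType) (n r : nat) (m : 'I_r -> nat)
    (f : {mpoly K[nvars n m]})
    (v : 'I_n -> forall j : 'I_r, 'rV[K]_(m j).+1) : K :=
  f.@[fun x => let: (k, t) := (enum_val x : pvar n m) in
               v k (tag t) 0 (tagged t)].

(* For multihomogeneous f, the vanishing does not depend on v. *)
Definition vanishes_at (K : fieldType) (n r : nat) (m : 'I_r -> nat)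
    (f : {mpoly K[nvars n m]}) (P : 'I_n -> mproj K m) : Prop :=
  forall v : 'I_n -> forall j : 'I_r, 'rV[K]_(m j).+1,
    (forall k j, has_coords (P k j) (v k j)) -> eval_coords f v = 0.

Definition zariski_closed (K : fieldType) (n r : nat) (m : 'I_r -> nat)
    (Z : ('I_n -> mproj K m) -> Prop) : Prop :=
  exists S : {mpoly K[nvars n m]} -> Prop,
    (forall f, S f -> multihomogeneous f) /\
    (forall P, Z P <-> forall f, S f -> vanishes_at f P).

Definition vanishing_ideal (K : fieldType) (n r : nat) (m : 'I_r -> nat)
    (Z : ('I_n -> mproj K m) -> Prop) : {mpoly K[nvars n m]} -> Prop :=
  in_ideal (fun f => multihomogeneous f /\ forall P, Z P -> vanishes_at f P).

(* A hyperplane of P^M is a linear subspace of dimension M of K^(M+1). *)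
Definition on_common_hyperplane (K : fieldType) (n r : nat) (m : 'I_r -> nat)
    (P : 'I_n -> mproj K m) : Prop :=
  exists H : {vspace 'rV[K]_(Mseg m).+1},
    \dim H = Mseg m /\ forall k, (val (segre (P k)) <= H)%VS.

Definition Seg (K : fieldType) (n r : nat) (m : 'I_r -> nat)
    (P : 'I_n -> mproj K m) : Prop :=
  forall Z : ('I_n -> mproj K m) -> Prop, zariski_closed Z ->
    (forall Q, on_common_hyperplane Q -> Z Q) -> Z P.

Lemma Seg_closed (K : fieldType) (n r : nat) (m : 'I_r -> nat) :
  zariski_closed (@Seg K n r m).
Proof.
exists (fun f => multihomogeneous f /\
          forall Q : 'I_n -> mproj K m, on_common_hyperplane Q -> vanishes_at f Q).
split=> [f []//|P]; split=> [hP f [hf vf]|hP Z [S [hS hZ]] subZ].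
  apply: (hP (fun Q => vanishes_at f Q)) => //.
  exists (fun g => g = f); split=> [_ ->//|Q].
  by split=> [? _ ->//|]; apply.
apply/hZ => f Sf; apply: hP; split; first exact: hS.
by move=> Q /subZ/hZ; apply.
Qed.

Definition Nmat (K : fieldType) (n r : nat) (m : 'I_r -> nat) :
    'M[{mpoly K[nvars n m]}]_(n, (Mseg m).+1) :=
  \matrix_(k, a) \prod_(j < r) pX K k (idx_of a j).

Definition increasing (p n : nat) (f : {ffun 'I_p -> 'I_n}) : bool :=
  [forall a : 'I_p, forall b : 'I_p, (a < b)%N ==> (f a < f b)%N].

Definition maximal_minors (K : fieldType) (n r : nat) (m : 'I_r -> nat) :
    seq {mpoly K[nvars n m]} :=
  [seq \det (rowsub f (Nmat K n m)) | f : {ffun 'I_(Mseg m).+1 -> 'I_n}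
     in [pred f | increasing f]].

(* Main.v *)
(* Let mu be the leading monomial of some f in the vanishing ideal, and let
   c k a be the exponent of the entry (k, a) of the matrix.  The tropical linear
   inequalities attached to the entries dividing mu (no such entry is the unique
   maximum of w a + c k a in its row) form a min-max system, for which there are
   two cases.
   - Unsolvable: there is an injective choice a |-> kap a of rows with every
     entry (kap a, a) dividing mu, such that the diagonal term of the minor on
     these rows is its leading monomial.  This leading monomial divides mu.
   - Solvable by some w: degenerate the points onto the hyperplane with
     coefficients X^(w a), by solving in each row the equation of the hyperplane
     for one suitable coordinate.  This does not affect the leading term of f,
     so f does not vanish at some configuration on a common hyperplane, a
     contradiction. *)
Require Import Defs.
From mathcomp Require Import all_boot all_order all_algebra all_fingroup complex mpoly reals.

Set Implicit Arguments.
Unset Strict Implicit.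
Unset Printing Implicit Defensive.

Import Order.TTheory GRing.Theory Num.Theory.
Local Open Scope ring_scope.

(** * Monomial orders: cancellation and maxima *)

Section MonomialOrder.

Variables (N : nat) (le : rel 'X_{1..N}).
Hypothesis le_mon : monomial_order le.

Lemma mo_refl : reflexive le. Proof. by case: le_mon => -[]. Qed.
Lemma mo_anti : antisymmetric le. Proof. by case: le_mon => -[]. Qed.
Lemma mo_trans : transitive le. Proof. by case: le_mon. Qed.
Lemma mo_total : total le. Proof. by case: le_mon. Qed.
Lemma mo_ge0 a : le 0%MM a. Proof. by case: le_mon. Qed.

(** Totality and cancellation of exponents upgrade compatibility with addition to an equivalence.
    This replaces subtraction below. *)
Lemma mo_add2r c a b : le (a + c)%MM (b + c)%MM = le a b.
Proof.
case: le_mon => _ _ _ _ leD; apply/idP/idP => [lec|]; last exact: leD.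
case/orP: (mo_total a b) => // /(leD _ _ c) lec'.
have /addIm -> : (a + c = b + c)%MM by apply: mo_anti; rewrite lec.
exact: mo_refl.
Qed.

Lemma mo_add2l c a b : le (c + a)%MM (c + b)%MM = le a b.
Proof. by rewrite ![(c + _)%MM]addmC mo_add2r. Qed.

Lemma mo_add a b a' b' : le a b -> le a' b' -> le (a + a')%MM (b + b')%MM.
Proof.
move=> ab ab'; apply: (@mo_trans (b + a')%MM); first by rewrite mo_add2r.
by rewrite mo_add2l.
Qed.

Lemma mo_addl a b c : le a b -> le a (c + b)%MM.
Proof. by move=> ab; rewrite -[a]add0m mo_add ?mo_ge0. Qed.

Lemma mo_addr a b c : le a b -> le a (b + c)%MM.
Proof. by rewrite addmC; apply: mo_addl. Qed.

Lemma mo_ltNge a b : ~~ le a b -> le b a.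
Proof. by case/orP: (mo_total a b) => // ->. Qed.

Definition mo_max a b := if le a b then b else a.

Lemma mo_maxl a b : le a (mo_max a b).
Proof. by rewrite /mo_max; case: ifP => // _; exact: mo_refl. Qed.

Lemma mo_maxr a b : le b (mo_max a b).
Proof.
rewrite /mo_max; case: ifP => [_|/negbT /mo_ltNge//]; exact: mo_refl.
Qed.

Lemma mo_argmax (I : finType) (i0 : I) (P : pred I) (F : I -> 'X_{1..N}) :
  P i0 -> exists2 i, P i & forall j, P j -> le (F j) (F i).
Proof.
move=> Pi0; pose ge a b := le b a.
have ge_refl : reflexive ge by exact: mo_refl.
have ge_trans : transitive ge by move=> b a c ab bc; exact: mo_trans bc ab.
have ge_total : total ge by move=> a b; exact: mo_total.
by case: (extremumP F ge_refl ge_trans ge_total Pi0) => i Pi iP; exists i.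
Qed.

End MonomialOrder.

(** * Min-max systems over a monomial order *)

Section Dichotomy.

Variables (N : nat) (le : rel 'X_{1..N}).
Hypothesis le_mon : monomial_order le.
Variables (n d : nat) (c : 'I_n -> 'I_d -> 'X_{1..N}).

(** Tropical nonsingularity: the tropical determinant of the square matrix with rows [kap] is
    attained at the identity only. *)
Definition dominating (kap : 'I_d -> 'I_n) := forall s : 'S_d, s != 1%g ->
  ~~ le (\sum_a c (kap a) a)%MM (\sum_a c (kap a) (s a))%MM.

Definition balanced (K : 'I_d -> {set 'I_n}) (w : 'I_d -> 'X_{1..N}) :=
  forall a k, k \in K a ->
    exists2 b, b != a & le (w a + c k a)%MM (w b + c k b)%MM.

Lemma balanced_shift K w e : balanced K w -> balanced K (fun a => e + w a)%MM.
Proof.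
move=> wP a k /wP[b ba le_ab]; exists b => //.
by rewrite -!addmA mo_add2l.
Qed.

Lemma orbit_sum (s : 'S_d) a (F : 'I_d -> 'X_{1..N}) :
  (\sum_(x in porbit s a) F x = \sum_(i < #|porbit s a|) F ((s ^+ i)%g a))%MM.
Proof.
pose t := traject s a #|porbit s a|.
have -> : (\sum_(x in porbit s a) F x = \sum_(x <- t) F x)%MM.
  rewrite [RHS]big_uniq ?uniq_traject_porbit //; apply: eq_bigl => x.
  exact: porbit_traject.
rewrite (big_nth a) size_traject big_mkord; apply: eq_bigr => i _.
by rewrite nth_traject ?permX.
Qed.

(* Around a cycle [s] along which the diagonal does not win, w is a partial
   sum of the weights, written without subtraction: going once around the
   cycle costs [sum of c (kap x) x] and earns [sum of c (kap x) (s x)]. *)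
Lemma balanced_orbit (kap : 'I_d -> 'I_n) (s : 'S_d) a0 : s a0 != a0 ->
  le (\sum_(x in porbit s a0) c (kap x) x)%MM
     (\sum_(x in porbit s a0) c (kap x) (s x))%MM ->
  exists w, balanced (fun a => [set kap a]) w.
Proof.
set C := porbit s a0 => sa0; rewrite !orbit_sum -/C.
pose x i := (s ^+ i)%g a0; pose l := #|C|.
pose u i := c (kap (x i)) (x i); pose v i := c (kap (x i)) (x i.+1).
rewrite (eq_bigr (fun i : 'I_l => u i)) // [X in le _ X](eq_bigr (fun i : 'I_l => v i)); last first.
  by move=> i _; rewrite /v /x expgSr permM.
move=> le_uv.
pose idx y := index y (traject s a0 l).
(* Up to the constant sum of all [v j], this is the partial sum of the differences [u j - v j]
   before [y]. Moving one step along the cycle replaces one [v i] by [u i]. *)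
pose w0 y := (\sum_(j < l) if (j < idx y)%N then u j else v j)%MM.
pose B := (\sum_y c (kap y) y)%MM.
have addBr y b z : le (c (kap y) y) (B + b + z)%MM.
  rewrite /B (bigD1 y) //=; do 3! apply: mo_addr => //; exact: mo_refl.
have l_gt0 : (0 < l)%N by apply/card_gt0P; exists a0; rewrite porbit_id.
have size_t : size (traject s a0 l) = l by rewrite size_traject.
have xE i : (i < l)%N -> x i = nth a0 (traject s a0 l) i.
  by move=> il; rewrite nth_traject // /x permX.
have idx_x i : (i < l)%N -> idx (x i) = i.
  by move=> il; rewrite xE // /idx index_uniq ?size_t ?uniq_traject_porbit.
have x_idx y : y \in C -> (idx y < l)%N /\ y = x (idx y).
  rewrite porbit_traject -/l => yt; have := yt; rewrite -index_mem size_t => lt.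
  by split=> //; rewrite xE // nth_index.
have xl : x l = a0 by rewrite /x permX iter_porbit.
(* The shift by [B] makes [a0] beat the diagonal entry in the rows [kap y] with [y] off the
   cycle. *)
exists (fun y => if y \in C then B + w0 y else 0)%MM => y k.
rewrite inE => /eqP ->; case: ifP => [yC|/negbT yC]; last first.
  have a0y : a0 != y by apply: contraNneq yC => <-; rewrite porbit_id.
  by exists a0; rewrite // porbit_id add0m.
have [] := x_idx _ yC; set i := idx y => il yE.
have sxC : x i.+1 \in C by exact: mem_porbit.
exists (x i.+1).
  rewrite [X in _ != X]yE; apply: contraNneq sa0.
  by rewrite /x expgS permM => /perm_inj ->.
rewrite sxC -!addmA mo_add2l //.
have -> : c (kap y) y = u i by rewrite /u -yE.
have -> : c (kap y) (x i.+1) = v i by rewrite /v -yE.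
pose i' := Ordinal il.
have w0y : (w0 y = v i + \sum_(j < l | j != i') if (j < i)%N then u j else v j)%MM.
  by rewrite /w0 (bigD1 i') //= ltnn.
(* Before the cycle closes the two sides are equal; only the closing edge uses [le_uv]. *)
have [il'|] := ltnP i.+1 l.
  have -> : (w0 (x i.+1) = u i + \sum_(j < l | j != i') if (j < i)%N then u j else v j)%MM.
    rewrite /w0 idx_x // (bigD1 i') //= ltnS leqnn; congr (_ + _)%MM.
    apply: eq_bigr => j ji; rewrite ltnS leq_eqVlt.
    by have /negbTE -> : (j != i :> nat) by [].
  rewrite w0y [X in le X _]addmC [X in le _ X]addmC !addmA [(u i + v i)%MM]addmC.
  exact: mo_refl.
move=> li; have {li} iS : i.+1 = l by apply/eqP; rewrite eqn_leq il.
have -> : w0 (x i.+1) = (\sum_(j < l) v j)%MM.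
  have x0 : x 0%N = a0 by rewrite /x perm1.
  by rewrite iS xl /w0 -x0 idx_x.
have -> : (w0 y + u i = \sum_(j < l) u j + v i)%MM.
  rewrite w0y [X in (_ = X + _)%MM](bigD1 i') //= -addmA addmC; congr (_ + _)%MM.
  rewrite addmC; congr (_ + _)%MM; apply: eq_bigr => j ji.
  have -> // : (j < i)%N.
  by rewrite ltn_neqAle ji -ltnS iS ltn_ord.
by rewrite mo_add2r.
Qed.

(** If domination fails, take a best permutation [s] among those different from 1 and a nontrivial
    cycle [C] of it. Let [t] be the identity on [C] and [s] elsewhere. If [t] is not 1, maximality
    of [s] shows that the diagonal does not win along [C]; if [t] is 1, then [s] moves only [C] and
    the failure of domination shows the same. *)
Lemma dichotomy1 (kap : 'I_d -> 'I_n) :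
  dominating kap \/ exists w, balanced (fun a => [set kap a]) w.
Proof.
pose bad (s : 'S_d) := (s != 1%g) &&
  le (\sum_a c (kap a) a)%MM (\sum_a c (kap a) (s a))%MM.
case: (pickP bad) => [s0 /andP[s0N1 s0P]|nobad]; last first.
  by left=> s sN1; have := nobad s; rewrite /bad sN1 /= => ->.
right.
have [s sN1 smax] := mo_argmax le_mon (P := fun s : 'S_d => s != 1%g)
  (fun s : 'S_d => \sum_a c (kap a) (s a))%MM s0N1.
have le_s := mo_trans le_mon s0P (smax _ s0N1).
have [a0 a0P] : exists a, s a != a.
  apply/existsP; rewrite -[X in is_true X]negbK negb_exists.
  apply: contra sN1 => /forallP id_s.
  by apply/eqP/permP => x; rewrite perm1; apply/eqP; have := id_s x; rewrite negbK.
apply: (balanced_orbit a0P).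
pose C := porbit s a0.
have sC x : (s x \in C) = (x \in C).
  by rewrite /C !(porbit_sym s _ a0) -!eq_porbit_mem -(porbit_perm s 1 x) expg1.
pose g x := if x \in C then x else s x.
have ginj : injective g.
  move=> x y; rewrite /g; case: ifP => xC; case: ifP => yC // e.
  - by rewrite -sC -e xC in yC.
  - by rewrite -sC e yC in xC.
  - exact: perm_inj e.
pose t := perm ginj.
have split_sum (F : 'I_d -> 'X_{1..N}) :
    (\sum_a F a = \sum_(a in C) F a + \sum_(a | a \notin C) F a)%MM.
  by rewrite (bigID (mem C)).
have sum_t : (\sum_a c (kap a) (t a) =
    \sum_(a in C) c (kap a) a + \sum_(a | a \notin C) c (kap a) (s a))%MM.
  rewrite split_sum; congr (_ + _)%MM; apply: eq_bigr => a.
    by rewrite permE /g => ->.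
  by rewrite permE /g => /negbTE ->.
have [t1|tN1] := eqVneq t 1%g; last first.
  by have := smax _ tN1; rewrite sum_t split_sum mo_add2r.
have id_s a : a \notin C -> s a = a.
  by move=> aC; have := permE ginj a; rewrite -/t t1 perm1 /g (negbTE aC).
have rest : (\sum_(a | a \notin C) c (kap a) (s a) =
             \sum_(a | a \notin C) c (kap a) a)%MM.
  by apply: eq_bigr => a /id_s ->.
by move: le_s; rewrite !split_sum rest mo_add2r.
Qed.

(* If K a has several elements, split it in two: componentwise maxima of
   solutions for the two parts, shifted so as to agree at a, solve the system
   for K. *)
Lemma dichotomy (K : 'I_d -> {set 'I_n}) :
  (exists2 kap, forall a, kap a \in K a & dominating kap)
  \/ exists w, balanced K w.
Proof.
have [q] := ubnP (\sum_a #|K a|); elim: q K => // q IHq K.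
rewrite ltnS => sizeK.
pose pin a k : 'I_d -> {set 'I_n} := fun b => if b == a then [set k] else K b.
pose del a k : 'I_d -> {set 'I_n} := fun b => if b == a then K a :\ k else K b.
case: (pickP (fun a => 1 < #|K a|)%N) => [a Ka|Kle1]; last first.
  case: (pickP (fun a => K a == set0)) => [a /eqP Ka0|KN0].
    (* Column [a] carries no condition, so a weight there that exceeds every entry settles all other
       columns. *)
    right; exists (fun b => if b == a then \sum_(k < n) \sum_(b < d) c k b else 0)%MM.
    move=> b k kKb; have bNa : b != a.
      by apply: contraTneq kKb => ->; rewrite Ka0 inE.
    exists a; first by rewrite eq_sym.
    rewrite (negbTE bNa) eqxx add0m; apply: mo_addr => //.
    rewrite (bigD1 k) //= (bigD1 b) //=; do 2! apply: mo_addr => //.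
    exact: mo_refl.
  have K1 a : exists k, K a == [set k].
    have : #|K a| == 1%N.
      by rewrite eqn_leq leqNgt Kle1 lt0n cards_eq0 KN0.
    by move/cards1P => [k ->]; exists k.
  pose kap a := xchoose (K1 a).
  have kapK a : K a = [set kap a] by apply/eqP; exact: (xchooseP (K1 a)).
  case: (dichotomy1 kap) => [dom|[w wP]]; [left|right].
    by exists kap => // a; rewrite kapK inE.
  by exists w => a k; rewrite kapK; exact: wP.
have [k kKa] : exists k, k \in K a by apply/card_gt0P/ltnW.
have lt_sum (K' : 'I_d -> {set 'I_n}) : (forall b, b != a -> K' b = K b) ->
    (#|K' a| < #|K a|)%N -> (\sum_b #|K' b| < q)%N.
  move=> eqK ltK; apply: leq_trans sizeK.
  rewrite (bigD1 a) //= [X in (_ < X)%N](bigD1 a) //=.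
  rewrite (eq_bigr (fun b => #|K b|)) ?ltn_add2r // => b ba.
  by rewrite eqK.
have {IHq} IH K' (eqK : forall b, b != a -> K' b = K b)
    (subK' : {subset K' a <= K a}) : (#|K' a| < #|K a|)%N ->
    (exists2 kap, forall a, kap a \in K a & dominating kap)
    \/ exists w, balanced K' w.
  move=> ltK; case: (IHq K' (lt_sum _ eqK ltK)) => [[kap kapK dom]|]; last by right.
  left; exists kap => // b; have [->|ba] := eqVneq b a; first exact/subK'/kapK.
  by rewrite -eqK.
have [||||[w1 w1P]] := IH (pin a k).
- by move=> b /negbTE; rewrite /pin => ->.
- by move=> x; rewrite /pin eqxx inE => /eqP ->.
- by rewrite /pin eqxx cards1.
- by left.
have [||||[w2 w2P]] := IH (del a k).
- by move=> b /negbTE; rewrite /del => ->.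
- by move=> x; rewrite /del eqxx inE => /andP[].
- by rewrite /del eqxx [X in (_ < X)%N](cardsD1 k) kKa.
- by left.
right.
pose v1 b := (w2 a + w1 b)%MM; pose v2 b := (w1 a + w2 b)%MM.
have {w1P} v1P : balanced (pin a k) v1 by exact: balanced_shift.
have {w2P} v2P : balanced (del a k) v2 by exact: balanced_shift.
have v12 : v1 a = v2 a by rewrite /v1 /v2 addmC.
pose w b := mo_max le (v1 b) (v2 b).
have v1w b : le (v1 b) (w b) by exact: mo_maxl.
have v2w b : le (v2 b) (w b) by exact: mo_maxr.
have lift (v : 'I_d -> 'X_{1..N}) b h : (forall b, le (v b) (w b)) ->
    (exists2 b', b' != b & le (v b + c h b)%MM (v b' + c h b')%MM) ->
    exists2 b', b' != b & le (v b + c h b)%MM (w b' + c h b')%MM.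
  move=> vw [b' b'b le_b]; exists b' => //; apply: (mo_trans le_mon le_b).
  by rewrite mo_add2r.
(* The left side of each inequality uses the solution that attains [w b]; passing to the maximum
   only enlarges the right side. At [a] the two solutions agree, so the one that treats the row [h]
   can be chosen. *)
exists w => b h hKb; have [ba|ba] := eqVneq b a.
  have wa : w a = v1 a by rewrite /w /mo_max v12; case: ifP.
  rewrite {}ba in hKb *; rewrite wa; have [hk|hk] := eqVneq h k.
    by apply: (lift v1) => //; apply: (v1P a h); rewrite /pin eqxx hk inE.
  by rewrite v12; apply: (lift v2) => //; apply: (v2P a h); rewrite /del eqxx !inE hk.
rewrite {1}/w /mo_max; case: ifP => _; last first.
  by apply: (lift v1) => //; apply: (v1P b h); rewrite /pin (negbTE ba).
by apply: (lift v2) => //; apply: (v2P b h); rewrite /del (negbTE ba).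
Qed.

End Dichotomy.

(** * Leading terms under rational substitution *)

Section TopCoefficient.

Variables (K : fieldType) (N : nat) (le : rel 'X_{1..N}).
Hypothesis le_mon : monomial_order le.
Implicit Types (p q : {mpoly K[N]}) (a b : 'X_{1..N}) (x y : K).

(* The value x = 0 is allowed, in which case a is only a strict upper bound. *)
Definition has_top p a x :=
  (forall b, b \in msupp p -> le b a) /\ p@_a = x.

Lemma has_top_neq0 p a x : has_top p a x -> x != 0 -> p != 0.
Proof. by case=> _ <-; apply: contraNneq => ->; rewrite mcoeff0. Qed.

Lemma has_topX a : has_top 'X_[a] a 1.
Proof.
split=> [b|]; last by rewrite mcoeffX eqxx.
by rewrite msuppX inE => /eqP ->; exact: mo_refl.
Qed.

Lemma has_top1 : has_top 1 0%MM 1.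
Proof. by rewrite -mpolyX0; exact: has_topX. Qed.

Lemma has_top0 a : has_top 0 a 0.
Proof. by split; rewrite ?mcoeff0 // => b; rewrite msupp0. Qed.

Lemma has_topN p a x : has_top p a x -> has_top (- p) a (- x).
Proof.
case=> le_a <-; split=> [b|]; last by rewrite mcoeffN.
by rewrite (perm_mem (msuppN p)); exact: le_a.
Qed.

Lemma has_topD p q a x y :
  has_top p a x -> has_top q a y -> has_top (p + q) a (x + y).
Proof.
move=> [lep <-] [leq <-]; split=> [b|]; last by rewrite mcoeffD.
by move/msuppD_le; rewrite mem_cat => /orP[/lep|/leq].
Qed.

Lemma has_topZ c p a x : has_top p a x -> has_top (c *: p) a (c * x).
Proof.
case=> le_a <-; split=> [b|]; last by rewrite mcoeffZ.
by move/msuppZ_le; exact: le_a.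
Qed.

Lemma has_top_sum (I : Type) (r : seq I) (P : pred I) (F : I -> {mpoly K[N]})
    a (x : I -> K) : (forall i, P i -> has_top (F i) a (x i)) ->
  has_top (\sum_(i <- r | P i) F i) a (\sum_(i <- r | P i) x i).
Proof.
move=> topF; elim/big_rec2: _ => [|i y p Pi]; first exact: has_top0.
exact: has_topD (topF i Pi).
Qed.

Lemma has_top_weak p a b x : has_top p a x -> le a b ->
  has_top p b (if a == b then x else 0).
Proof.
move=> [le_a pa] ab; split=> [e /le_a ea|]; first exact: mo_trans ea ab.
have [<-//|aNb] := eqVneq a b; apply/eqP; rewrite mcoeff_eq0.
apply: contra aNb => /le_a ba; apply/eqP; apply: (mo_anti le_mon).
by rewrite ab.
Qed.

(** By cancellation, two monomials bounded by [a] and [b] have sum [a + b] only if they equal [a]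
    and [b], so a single product contributes to the top coefficient. *)
Lemma has_topM p q a b x y :
  has_top p a x -> has_top q b y -> has_top (p * q) (a + b)%MM (x * y).
Proof.
move=> [lep pa] [leq qb]; split=> [e|].
  move/msuppM_le/allpairsP => [[e1 e2] /= [/lep e1a /leq e2b ->]].
  exact: mo_add.
have da : (mdeg a < (mdeg (a + b)%MM).+1)%N by rewrite ltnS mdegD leq_addr.
have db : (mdeg b < (mdeg (a + b)%MM).+1)%N by rewrite ltnS mdegD leq_addl.
rewrite mcoeffM (bigD1 (BMultinom da, BMultinom db)) //= pa qb.
rewrite big1 ?addr0 // => -[[e1 /= d1] [e2 /= d2]] /= /andP[/eqP e12 neq].
have [e1p|/memN_msupp_eq0 ->] := boolP (e1 \in msupp p); last by rewrite mul0r.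
have [e2q|/memN_msupp_eq0 ->] := boolP (e2 \in msupp q); last by rewrite mulr0.
have le1 := lep _ e1p; have le2 := leq _ e2q.
have e1a : e1 = a.
  apply: (mo_anti le_mon); rewrite le1 /=.
  rewrite -(mo_add2r le_mon b) e12 mo_add2l //.
have e2b : e2 = b by move: e12; rewrite e1a => /addmI.
case/negP: neq; apply/eqP; congr (_, _); exact: val_inj.
Qed.

Lemma has_top_prod (I : Type) (r : seq I) (F : I -> {mpoly K[N]})
    (a : I -> 'X_{1..N}) (x : I -> K) : (forall i, has_top (F i) (a i) (x i)) ->
  has_top (\prod_(i <- r) F i) (\sum_(i <- r) a i)%MM (\prod_(i <- r) x i).
Proof.
move=> topF; elim: r => [|i r IHr]; first by rewrite !big_nil; exact: has_top1.
by rewrite !big_cons; exact: has_topM.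
Qed.

Lemma has_topXn p a x k : has_top p a x -> has_top (p ^+ k) (a *+ k)%MM (x ^+ k).
Proof.
move=> topp; elim: k => [|k IHk]; first by rewrite !expr0 mulm0n; exact: has_top1.
by rewrite !exprS mulmS; exact: has_topM.
Qed.

(* The numerator of f after the substitution X_i := num i / den i. *)
Definition subst_num (num den : 'I_N -> {mpoly K[N]}) (f : {mpoly K[N]}) :=
  \sum_(a <- msupp f) f@_a *:
    \prod_i (num i ^+ a i * den i ^+ (msize f - a i)).

(** Hence the truncated subtraction in [subst_num] is exact. *)
Lemma mnm_le_msize (f : {mpoly K[N]}) a i : a \in msupp f -> (a i <= msize f)%N.
Proof.
move=> /msize_mdeg_lt /ltnW; apply: leq_trans.
by rewrite mdegE (bigD1 i) //= leq_addr.
Qed.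

Lemma meval_subst_num num den f (v : 'I_N -> K) :
  (forall i, (den i).@[v] != 0) ->
  (subst_num num den f).@[v] = (\prod_i (den i).@[v] ^+ msize f) *
     f.@[fun i => (num i).@[v] / (den i).@[v]].
Proof.
move=> den0; rewrite /subst_num raddf_sum [f.@[_]]mevalE big_distrr /=.
rewrite big_seq [RHS]big_seq; apply: eq_bigr => a af.
rewrite mevalZ rmorph_prod [RHS]mulrCA; congr (_ * _); rewrite -big_split /=.
apply: eq_bigr => i _; rewrite rmorphM !rmorphXn /= expr_div_n.
rewrite -[in RHS](subnK (mnm_le_msize i af)) exprD.
by rewrite [RHS]mulrACA divff ?expf_neq0 // mulr1 mulrC.
Qed.

(** Each quotient behaves like its variable: a monomial [b] of [f] yields a polynomial bounded by
    [b + E], with [E] common to all, so [a] stays on top. A vanishing [x i] is harmless where [a i]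
    is zero, since it then enters with exponent zero. *)
Lemma subst_num_neq0 num den (D : 'I_N -> 'X_{1..N}) (x y : 'I_N -> K) f a :
  is_lead_monomial le f a ->
  (forall i, has_top (num i) (D i + U_(i))%MM (x i)) ->
  (forall i, has_top (den i) (D i) (y i)) ->
  (forall i, y i != 0) -> (forall i, a i != 0%N -> x i != 0) ->
  subst_num num den f != 0.
Proof.
move=> [af alead] topn topd y0 x0.
pose B := msize f.
pose E := (\sum_i D i *+ B)%MM.
pose val b := \prod_i (x i ^+ b i * y i ^+ (B - b i)).
have top b : b \in msupp f ->
    has_top (\prod_i (num i ^+ b i * den i ^+ (B - b i))) (b + E)%MM (val b).
  move=> bf.
  have -> : (b + E = \sum_i ((D i + U_(i)) *+ b i + D i *+ (B - b i)))%MM.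
    rewrite {1}[b]multinomUE_id -big_split /=; apply: eq_bigr => i _.
    apply/mnmP => j; rewrite !(mnmDE, mulmnE) mulnDl addnAC addnC; congr (_ + _)%N.
    by rewrite -mulnDr subnKC // mnm_le_msize.
  apply: has_top_prod => i.
  by apply: has_topM; apply: has_topXn.
have topF : has_top (subst_num num den f) (a + E)%MM (f@_a * val a).
  have -> : f@_a * val a =
      \sum_(b <- msupp f | b \in msupp f) f@_b * (if (b + E == a + E)%MM then val b else 0).
    rewrite -big_seq (bigD1_seq a) ?msupp_uniq //= eqxx big1 ?addr0 // => b ba.
    by rewrite eqm_add2r (negbTE ba) mulr0.
  rewrite /subst_num big_seq; apply: has_top_sum => b bf; apply: has_topZ.
  by apply: has_top_weak (top b bf) _; rewrite mo_add2r // alead.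
apply: has_top_neq0 topF _; rewrite mulf_neq0 -?mcoeff_msupp //.
apply/prodf_neq0 => i _; apply: mulf_neq0; last exact: expf_neq0.
by have [->|/x0 xi] := eqVneq (a i) 0%N; rewrite ?expr0 ?oner_neq0 ?expf_neq0.
Qed.

End TopCoefficient.

(** * Points where a nonzero polynomial does not vanish *)

(** Uniqueness of base [B] digits: reduce modulo [B] for the lowest one, then induct on the
    quotient. *)
Lemma base_exp_inj (N B : nat) (a b : 'I_N -> nat) :
  (forall i, a i < B)%N -> (forall i, b i < B)%N ->
  (\sum_i a i * B ^ i = \sum_i b i * B ^ i)%N -> a =1 b.
Proof.
elim: N a b => [|N IHN] a b aB bB; first by move=> _ [].
have shift (e : 'I_N.+1 -> nat) :
    (\sum_i e i * B ^ i = (\sum_(i < N) e (lift ord0 i) * B ^ i) * B + e ord0)%N.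
  rewrite big_ord_recl muln1 addnC big_distrl /=; congr (_ + _)%N.
  by apply: eq_bigr => i _; rewrite expnSr mulnA.
rewrite !shift => eqab.
have B0 : (0 < B)%N by exact: leq_ltn_trans (aB ord0).
have := congr1 (fun x => x %% B)%N eqab.
rewrite !modnMDl !modn_small // => ab0.
move/eqP: eqab; rewrite ab0 eqn_add2r eqn_pmul2r // => /eqP /IHN eqab i.
by case: (unliftP ord0 i) => [j ->|->] //; apply: eqab.
Qed.

Section Nonvanishing.

Variables (K : numFieldType) (N : nat).

(** In characteristic zero the first [size p] natural numbers are distinct, and too many to be all
    roots. *)
Lemma poly_nonroot (p : {poly K}) : p != 0 -> exists t, p.[t] != 0.
Proof.
move=> p0; pose rs := [seq (k%:R : K) | k <- iota 0 (size p)].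
have [/allP all_rs|] := boolP (all (root p) rs); last first.
  by case/allPn => t _ rt; exists t.
have urs : uniq rs by rewrite map_inj_uniq ?iota_uniq //; exact: (mulrIn (oner_neq0 K)).
have := max_poly_roots p0 (introT allP all_rs) urs.
by rewrite size_map size_iota ltnn.
Qed.

(* Kronecker substitution X_i := t^(B^i). *)
Lemma mpoly_nonroot (f : {mpoly K[N]}) : f != 0 -> exists v, f.@[v] != 0.
Proof.
move=> f0; pose B := (msize f).+1.
pose e (a : 'X_{1..N}) := (\sum_i a i * B ^ i)%N.
pose p : {poly K} := \sum_(a <- msupp f) f@_a *: 'X^(e a).
have a0f := mlead_supp f0; set a0 := mlead f in a0f.
have einj a b : a \in msupp f -> b \in msupp f -> e a = e b -> a = b.
  move=> af bf eab; apply/mnmP; apply: (base_exp_inj (B := B)) eab => i;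
  by rewrite ltnS mnm_le_msize.
have pN0 : p != 0.
  suff: p`_(e a0) != 0 by apply: contraNneq => ->; rewrite coef0.
  rewrite /p coef_sum (bigD1_seq a0) ?msupp_uniq //= big_seq_cond big1.
    by rewrite addr0 coefZ coefXn eqxx mulr1 -mcoeff_msupp.
  move=> b /andP[bf ba]; rewrite coefZ coefXn.
  case: eqP => [/(einj _ _ a0f bf) ab|_]; last by rewrite mulr0.
  by rewrite ab eqxx in ba.
have [t pt] := poly_nonroot pN0; exists (fun i => t ^+ (B ^ i)).
suff -> : f.@[fun i : 'I_N => t ^+ (B ^ i)] = p.[t] by [].
rewrite mevalE /p horner_sum; apply: eq_bigr => a _.
rewrite hornerZ hornerXn /e -prodrXr; congr (_ * _); apply: eq_bigr => i _.
by rewrite -exprM mulnC.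
Qed.

End Nonvanishing.

(** * Generated ideals *)

Section Ideals.

Variables (K : fieldType) (N : nat).
Implicit Types (S T : {mpoly K[N]} -> Prop) (f g h : {mpoly K[N]}).

Lemma in_ideal_gen S f : S f -> in_ideal S f.
Proof.
move=> Sf; exists [:: (1, f)]; split=> [q|]; last by rewrite big_seq1 mul1r.
by rewrite inE => /eqP ->.
Qed.

Lemma in_idealMl S h f : in_ideal S f -> in_ideal S (h * f).
Proof.
move=> [s [sS ->]]; exists [seq (h * q.1, q.2) | q <- s]; split=> [q|].
  by case/mapP => q' /sS Sq ->.
by rewrite big_map big_distrr /=; apply: eq_bigr => q _; rewrite mulrA.
Qed.

Lemma in_idealD S f g : in_ideal S f -> in_ideal S g -> in_ideal S (f + g).
Proof.
move=> [s [sS ->]] [t [tS ->]]; exists (s ++ t); split; last by rewrite big_cat.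
by move=> q; rewrite mem_cat => /orP[/sS|/tS].
Qed.

Lemma in_ideal_trans S T f :
  (forall g, S g -> in_ideal T g) -> in_ideal S f -> in_ideal T f.
Proof.
move=> ST [s [sS ->]]; elim: s sS => [_|q s IHs sS].
  by rewrite big_nil; exists [::]; rewrite big_nil.
rewrite big_cons; apply: in_idealD; last first.
  by apply: IHs => q' q's; apply: sS; rewrite inE q's orbT.
by apply/in_idealMl/ST/sS; rewrite inE eqxx.
Qed.

Lemma in_ideal_meval0 S f (v : 'I_N -> K) :
  (forall g, S g -> g.@[v] = 0) -> in_ideal S f -> f.@[v] = 0.
Proof.
move=> S0 [s [sS ->]]; rewrite raddf_sum big_seq big1 // => q /sS/S0 q0.
by rewrite /= mevalM q0 mulr0.
Qed.

End Ideals.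

Lemma mpolyX_sum (K : fieldType) (N : nat) (I : Type) (s : seq I) (P : pred I)
    (F : I -> 'X_{1..N}) :
  'X_[(\sum_(i <- s | P i) F i)%MM] = \prod_(i <- s | P i) 'X_[F i] :> {mpoly K[N]}.
Proof. exact: (big_morph _ (@mpolyXD N K) (mpolyX0 N K)). Qed.

(** * Monomials of the Segre matrix *)

Section Segre.

Variables (n r : nat) (m : 'I_r -> nat).
Local Notation d := (Mseg m).+1.
Local Notation nv := (nvars n m).

Lemma var_idxE (k k' : 'I_n) (j j' : 'I_r) (i : 'I_(m j).+1) (a : midx m) :
  (var_idx k i == var_idx k' (a j')) = [&& k == k', j == j' & i == a j].
Proof.
rewrite /var_idx (inj_eq enum_rank_inj) xpair_eqE; congr (_ && _).
have [<-|jj'] := eqVneq j j'; first by rewrite eq_Tagged.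
by apply/negbTE; apply: contra jj' => /eqP /(congr1 tag) /= ->.
Qed.

Lemma var_idxP (x : 'I_nv) : exists k j (i : 'I_(m j).+1), x = var_idx k i.
Proof.
case: (enum_val x) (enum_valK x) => k [j i] <-.
by exists k, j, i.
Qed.

Definition entry_mnm (k : 'I_n) (a : 'I_d) : 'X_{1..nv} :=
  (\sum_j U_(var_idx k (idx_of a j)))%MM.

Lemma entry_mnmE k a k' j (i : 'I_(m j).+1) :
  entry_mnm k a (var_idx k' i) = (k' == k) && (i == idx_of a j).
Proof.
rewrite /entry_mnm mnm_sumE (bigD1 j) //= mnmE eq_sym var_idxE eqxx /=.
rewrite big1 ?addn0 // => j' jj'.
by rewrite mnmE eq_sym var_idxE [j == j']eq_sym (negbTE jj') andbF.
Qed.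

Lemma idx_of_inj : injective (@idx_of r m).
Proof. by move=> a b /enum_val_inj /cast_ord_inj. Qed.

(** Entries in distinct rows share no variable, and a product of pairwise coprime divisors is a
    divisor. *)
Lemma entry_mnm_sum_le (kap : 'I_d -> 'I_n) (mu : 'X_{1..nv}) :
  injective kap -> (forall a, (entry_mnm (kap a) a <= mu)%MM) ->
  (\sum_a entry_mnm (kap a) a <= mu)%MM.
Proof.
move=> kap_inj le_mu; apply/mnm_lepP => x.
have [k [j [i ->]]] := var_idxP x; rewrite mnm_sumE.
case: (pickP (fun a => k == kap a)) => [a /eqP ka|kapN]; last first.
  by rewrite big1 // => a _; rewrite entry_mnmE kapN.
rewrite (bigD1 a) //= big1 ?addn0; first exact: (mnm_lepP (le_mu a)).
move=> b ba; rewrite entry_mnmE ka (inj_eq kap_inj) eq_sym.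
by rewrite (negbTE ba).
Qed.

(** * Maximal minors: vanishing and leading monomials *)

Section Minors.

Variable K : fieldType.
Implicit Type f : {ffun 'I_d -> 'I_n}.

Lemma NmatE k a : Nmat K n m k a = 'X_[entry_mnm k a].
Proof. by rewrite mxE /entry_mnm mpolyX_sum. Qed.

Lemma minorE f : \det (rowsub f (Nmat K n m)) =
  \sum_(s : 'S_d) (-1) ^+ s *: 'X_[\sum_a entry_mnm (f a) (s a)].
Proof.
apply: eq_bigr => s _; rewrite mpolyX_sum -mul_mpolyC rmorphXn rmorphN1.
by congr (_ * _); apply: eq_bigr => a _; rewrite mxE NmatE.
Qed.

Lemma minor_multihomogeneous f : multihomogeneous (\det (rowsub f (Nmat K n m))).
Proof.
(* An entry of row [k] has degree one in each coordinate group of that row, so the degree counts how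
   often [f] selects row [k]. *)
exists (fun k _ => (\sum_a (k == f a))%N) => e + k j.
rewrite minorE => /msupp_sum_le /flattenP [_ /mapP[s _ ->]] /msuppZ_le.
rewrite msuppX inE => /eqP ->.
rewrite (eq_bigr (fun i : 'I_(m j).+1 =>
  \sum_a ((k == f a) && (i == idx_of (s a) j)))%N); last first.
  by move=> i _; rewrite mnm_sumE; apply: eq_bigr => a _; rewrite entry_mnmE.
rewrite exchange_big; apply: eq_bigr => a _ /=.
rewrite (bigD1 (idx_of (s a) j)) //= eqxx andbT big1 ?addn0 // => i ia.
by rewrite (negbTE ia) andbF.
Qed.

Lemma eval_minor f (v : 'I_n -> forall j : 'I_r, 'rV[K]_(m j).+1) :
  eval_coords (\det (rowsub f (Nmat K n m))) v =
  \det (\matrix_(a < d) segre_vec (v (f a))).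
Proof.
rewrite /eval_coords -det_map_mx; congr (\det _); apply/matrixP => a b.
rewrite !mxE /= rmorph_prod; apply: eq_bigr => j _.
by apply: etrans (mevalXU _ _) _; rewrite /var_idx enum_rankK.
Qed.

Lemma hyperplane_det0 (H : {vspace 'rV[K]_d}) (A : 'M[K]_d) :
  \dim H = Mseg m -> (forall a, row a A \in H) -> \det A = 0.
Proof.
move=> dimH AH; apply/eqP/negPn/negP => detA.
have Au : A \in unitmx by rewrite unitmxE unitfE.
have : (fullv <= H)%VS.
  apply/subvP => x _; rewrite -[x](mulmxKV Au) mulmx_sum_row.
  by apply: memv_suml => a _; apply/memvZ/AH.
by move/dimvS; rewrite dimvf dimH dim_matrix mul1r ltnn.
Qed.

(** The zero locus of the minor is closed and contains all configurations on a common hyperplane,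
    hence contains [Seg]. *)
Lemma minor_vanishes f (P : 'I_n -> mproj K m) : Seg P ->
  vanishes_at (\det (rowsub f (Nmat K n m))) P.
Proof.
set g := \det _; move=> /(_ (fun Q => vanishes_at g Q)); apply.
  exists (fun h => h = g); split=> [_ ->|Q]; first exact: minor_multihomogeneous.
  by split=> [? _ ->//|]; apply.
move=> Q [H [dimH QH]] v vQ; rewrite eval_minor.
apply: hyperplane_det0 dimH _ => a; rewrite rowK.
apply: (subvP (QH (f a))); rewrite (segreE (vQ (f a))); exact: memv_line.
Qed.

Lemma minor_in_ideal g : g \in maximal_minors K n m ->
  vanishing_ideal (@Seg K n r m) g.
Proof.
case/imageP => f _ ->; apply: in_ideal_gen; split.
  exact: minor_multihomogeneous.
by move=> P; exact: minor_vanishes.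
Qed.

Variable le : rel 'X_{1..nv}.
Hypothesis le_mon : monomial_order le.

(** If two columns shared a row, transposing them would give the same monomial, against strict
    domination. *)
Lemma dominating_inj (kap : 'I_d -> 'I_n) : dominating le entry_mnm kap -> injective kap.
Proof.
move=> dom a b kab; apply/eqP/negPn/negP => ab.
pose s := tperm a b.
have sN1 : s != 1%g.
  by apply: contraNneq ab => s1; rewrite -[a in a == _](perm1 a) -s1 tpermL.
have kaps x : kap (s x) = kap x by rewrite /s; case: tpermP => // ->.
case/negP: (dom s sN1).
have -> : (\sum_x entry_mnm (kap x) (s x) = \sum_x entry_mnm (kap x) x)%MM.
  rewrite [RHS](reindex_inj (@perm_inj _ s)).
  by apply: eq_bigr => x _; rewrite kaps.
exact: mo_refl.
Qed.

(** The listed minors use increasing row selections; this sorts the rows of [kap] at the cost of a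
    permutation. *)
Lemma increasing_enum (kap : 'I_d -> 'I_n) : injective kap ->
  exists (f : {ffun 'I_d -> 'I_n}) (t : 'S_d), increasing f /\ forall a, kap a = f (t a).
Proof.
move=> kap_inj; pose S := kap @: [set: 'I_d].
have cardS : d = #|S| by rewrite card_imset // cardsT card_ord.
pose f := [ffun a => enum_val (cast_ord cardS a)].
have kS a : kap a \in S by apply: imset_f.
have fP a : exists b, kap a == f b.
  exists (cast_ord (esym cardS) (enum_rank_in (kS a) (kap a))).
  by rewrite ffunE cast_ordKV enum_rankK_in.
pose t a := xchoose (fP a).
have tP a : kap a = f (t a) by apply/eqP; exact: (xchooseP (fP a)).
have t_inj : injective t by move=> a b tab; apply: kap_inj; rewrite !tP tab.
exists f, (perm t_inj); split=> [|a]; last by rewrite permE.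
apply/forallP => a; apply/forallP => b; apply/implyP => ab; rewrite !ffunE.
have x0 := f a; rewrite !(enum_val_nth x0) /=.
have S_sorted : sorted (relpre val ltn) (enum S).
  rewrite /enum_mem; apply: sorted_filter; first by move=> y x z; exact: ltn_trans.
  by rewrite -enumT -sorted_map val_enum_ord iota_ltn_sorted.
apply: (sorted_ltn_nth _ x0 S_sorted) => //; first by move=> y x z; exact: ltn_trans.
  by rewrite inE -cardE -cardS.
by rewrite inE -cardE -cardS.
Qed.

Lemma minor_lead (kap : 'I_d -> 'I_n) : dominating le entry_mnm kap ->
  exists2 g, g \in maximal_minors K n m &
    is_lead_monomial le g (\sum_a entry_mnm (kap a) a)%MM.
Proof.
move=> dom; have [f [t [f_inc kapE]]] := increasing_enum (dominating_inj dom).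
exists (\det (rowsub f (Nmat K n m))); first by apply/imageP; exists f.
set e := (\sum_a _)%MM.
(* After sorting the rows by [t], the diagonal of [kap] is the term of the permutation inverse to
   [t]; all other terms are strictly smaller. *)
have top : has_top le (\det (rowsub f (Nmat K n m))) e
    (\sum_(s : 'S_d) if s == t^-1%g then (-1) ^+ s else 0).
  rewrite minorE; apply: has_top_sum => s _.
  have -> : (\sum_a entry_mnm (f a) (s a) = \sum_a entry_mnm (kap a) ((t * s)%g a))%MM.
    rewrite (reindex_inj (@perm_inj _ t)); apply: eq_bigr => a _.
    by rewrite permM kapE.
  have [->|st] := eqVneq s t^-1%g.
    rewrite mulgV -[X in has_top _ _ _ X]mulr1; apply: has_topZ.
    have -> : (\sum_a entry_mnm (kap a) ((1 : 'S_d)%g a) = e)%MM.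
      by apply: eq_bigr => a _; rewrite perm1.
    exact: has_topX.
  have ts1 : (t * s)%g != 1%g by apply: contraNneq st => ts; rewrite -(mulKg t s) ts mulg1.
  have lt := dom _ ts1.
  rewrite -[X in has_top _ _ _ X](mulr0 ((-1) ^+ s)); apply: has_topZ.
  have := has_top_weak le_mon (has_topX K le_mon _) (mo_ltNge le_mon lt).
  by case: eqP => // E; case/negP: lt; rewrite E; exact: mo_refl.
case: top => le_e top; split=> //; rewrite mcoeff_msupp top.
rewrite (bigD1 t^-1%g) //= eqxx big1 ?addr0; last by move=> s /negbTE ->.
by rewrite signr_eq0.
Qed.

End Minors.
End Segre.

(** * Degeneration onto a hyperplane *)

Section Parametrization.

Variables (K : numFieldType) (n r : nat) (m : 'I_r -> nat).
Hypothesis m_gt0 : forall j, (1 <= m j)%N.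
Local Notation d := (Mseg m).+1.
Local Notation nv := (nvars n m).
Local Notation c := (@entry_mnm n r m).

Variables (le : rel 'X_{1..nv}) (f : {mpoly K[nv]}) (mu : 'X_{1..nv}).
Hypotheses (le_mon : monomial_order le) (f_mu : is_lead_monomial le f mu).
Variable w : 'I_d -> 'X_{1..nv}.
Hypothesis w_bal : balanced le c (fun a => [set k | (c k a <= mu)%MM]) w.

(** Take a maximal term [b] of row [k]. If its entry does not divide [mu], one of its variables is
    absent from [mu], because entries are squarefree. Otherwise balance gives a second maximal term,
    and any factor where the two multi-indices differ serves. *)
Lemma solvable_variable k : exists bj : 'I_d * 'I_r,
  (forall a, le (w a + c k a)%MM (w bj.1 + c k bj.1)%MM) /\
  (mu (var_idx k (idx_of bj.1 bj.2)) != 0%N ->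
   exists2 a, idx_of a bj.2 != idx_of bj.1 bj.2 &
     (w a + c k a = w bj.1 + c k bj.1)%MM).
Proof.
have [b _ bmax] := mo_argmax le_mon (P := fun _ : 'I_d => true) (i0 := ord0)
  (fun a => w a + c k a)%MM isT.
have [cb|] := boolP (c k b <= mu)%MM; last first.
  case/forallPn => x; rewrite -ltnNge.
  have [k' [j [i ->]]] := var_idxP x; rewrite entry_mnmE.
  case: andP => // -[/eqP -> /eqP ->]; rewrite ltnS leqn0 => /eqP mu0.
  by exists (b, j); split=> [a|/=]; [exact: bmax | rewrite mu0].
have [|a ab le_ba] := w_bal (a := b) (k := k); first by rewrite inE.
have [j jP] : exists j, idx_of a j != idx_of b j.
  apply/existsP; apply: contraNT ab; rewrite negb_exists => /forallP eq_ab.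
  apply/eqP/idx_of_inj/ffunP => j; apply/eqP.
  by have := eq_ab j; rewrite negbK.
exists (b, j); split=> [a'|_]; first exact: bmax.
by exists a => //; apply: (mo_anti le_mon); rewrite /= le_ba bmax.
Qed.

(* Take the hyperplane with coefficients X^(w a), and on each row k solve its
   equation [x_k * C k + S k = 0] for one variable x_k, chosen so that the
   leading monomial of S k / C k is at most x_k, with equality if x_k divides
   X^mu: the substitution x_k := - S k / C k then preserves the leading term. *)
Lemma hyperplane_witness : exists (u : 'I_d -> K)
    (v : 'I_n -> forall j : 'I_r, 'rV[K]_(m j).+1),
  [/\ forall a, u a != 0, forall k j, v k j != 0,
      forall k, \sum_a u a * segre_vec (v k) 0 a = 0 & eval_coords f v != 0].
Proof.
have [bj bjP] := fin_all_exists solvable_variable.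
pose b (k : 'I_n) := (bj k).1; pose jj (k : 'I_n) := (bj k).2.
pose xk k := var_idx k (idx_of (b k) (jj k)) : 'I_nv.
pose sel (k : 'I_n) (a : 'I_d) := idx_of a (jj k) == idx_of (b k) (jj k).
pose cof (k : 'I_n) (a : 'I_d) := (\sum_(j | j != jj k) U_(var_idx k (idx_of a j)))%MM.
have cE k a : (c k a = U_(var_idx k (idx_of a (jj k))) + cof k a)%MM.
  by rewrite /entry_mnm (bigD1 (jj k)).
have cE_sel k a : sel k a -> (c k a = cof k a + U_(xk k))%MM.
  by move=> /eqP selka; rewrite cE addmC selka.
have selb k : sel k (b k) by rewrite /sel.
pose C (k : 'I_n) : {mpoly K[nv]} := \sum_(a | sel k a) 'X_[(w a + cof k a)%MM].
pose S (k : 'I_n) : {mpoly K[nv]} := \sum_(a | ~~ sel k a) 'X_[(w a + c k a)%MM].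
pose L (k : 'I_n) := (w (b k) + cof k (b k))%MM.
have LE k : (L k + U_(xk k) = w (b k) + c k (b k))%MM.
  by rewrite (cE_sel _ _ (selb k)) addmA.
(* [y] and [x] count the terms of [C] and [S] that reach the expected top; in characteristic zero
   such a count is nonzero once one term does. *)
pose y (k : 'I_n) : K := \sum_(a | sel k a) (w a + cof k a == L k)%MM%:R.
pose x (k : 'I_n) : K := \sum_(a | ~~ sel k a) (w a + c k a == L k + U_(xk k))%MM%:R.
have boolE (e : bool) : e%:R = (if e then 1 else 0) :> K by case: e.
have topC k : has_top le (C k) (L k) (y k).
  apply: has_top_sum => a sela.
  rewrite boolE.
  apply: has_top_weak => //; first exact: has_topX.
  rewrite -(mo_add2r le_mon U_(xk k)) LE -addmA -cE_sel //.
  by case: (bjP k).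
have topS k : has_top le (S k) (L k + U_(xk k))%MM (x k).
  apply: has_top_sum => a _.
  rewrite boolE.
  apply: has_top_weak => //; first exact: has_topX.
  by rewrite LE; case: (bjP k).
have sum_neq0 (P e : pred 'I_d) a : P a -> e a -> \sum_(a | P a) (e a)%:R != 0 :> K.
  move=> Pa ea; rewrite -natr_sum pnatr_eq0 -lt0n (bigD1 a) //= ea.
  by rewrite addn_gt0.
have y0 k : y k != 0 by apply: (sum_neq0 _ _ (b k)).
have x0 k : mu (xk k) != 0%N -> x k != 0.
  case: (bjP k) => _ H /H [a aj ea].
  by apply: (sum_neq0 _ _ a); rewrite // LE ea.
pose row (i : 'I_nv) : 'I_n := (enum_val i : pvar n m).1.
have row_var (k : 'I_n) j (i : 'I_(m j).+1) : row (var_idx k i) = k.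
  by rewrite /row /var_idx enum_rankK.
pose solved i := i == xk (row i).
pose num i := if solved i then - S (row i) else 'X_i.
pose den i := if solved i then C (row i) else 1.
pose D i := if solved i then L (row i) else 0%MM.
have F0 : subst_num num den f != 0.
  apply: (subst_num_neq0 le_mon (D := D) (y := fun i => if solved i then y (row i) else 1)
    (x := fun i => if solved i then - x (row i) else 1) f_mu) => i;
  rewrite /num /den /D.
  - case: ifP => [sol|_]; last by rewrite add0m; exact: has_topX.
    by have := has_topN (topS (row i)); rewrite -(eqP sol).
  - by case: ifP => _; [exact: topC | exact: has_top1].
  - by case: ifP => _; [exact: y0 | exact: oner_neq0].
  - case: ifP => [sol|_ _]; last exact: oner_neq0.
    by rewrite oppr_eq0 => mui; apply: x0; rewrite -(eqP sol).
have den0 i : den i != 0.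
  rewrite /den; case: ifP => _; last exact: oner_neq0.
  exact: has_top_neq0 (topC _) (y0 _).
(* One point outside the zeros of [G] keeps the numerator, all denominators, the free coordinates
   and the hyperplane coefficients nonzero at once. *)
pose G := subst_num num den f * (\prod_i ('X_i * den i)).
have G0 : G != 0.
  apply: mulf_neq0 => //; apply/prodf_neq0 => i _; apply: mulf_neq0 => //.
  by rewrite -msupp_eq0 msuppX.
have [v0] := mpoly_nonroot G0.
rewrite /G rmorphM rmorph_prod mulf_eq0 negb_or /= => /andP[Fv0 /prodf_neq0 prod0].
have v0N0 i : v0 i != 0.
  by have := prod0 i isT; rewrite rmorphM mulf_eq0 negb_or /= mevalXU => /andP[].
have denv0 i : (den i).@[v0] != 0.
  by have := prod0 i isT; rewrite rmorphM mulf_eq0 negb_or /= => /andP[].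
pose z i := (num i).@[v0] / (den i).@[v0].
have z_free i : ~~ solved i -> z i = v0 i.
  by move=> /negbTE nsol; rewrite /z /num /den nsol mevalXU meval1 divr1.
have solved_xk k : solved (xk k) by rewrite /solved row_var.
have solved_var k (a : midx m) j : solved (var_idx k (a j)) =
    (j == jj k) && (a j == idx_of (b k) j).
  by rewrite /solved row_var var_idxE eqxx.
exists (fun a => 'X_[w a].@[v0]), (fun k j => \row_i z (var_idx k i)); split.
- by move=> a; rewrite mevalX; apply/prodf_neq0 => i _; rewrite expf_neq0.
- move=> k j; apply/rV0Pn.
  (* Since [m j] is positive, each factor has a coordinate other than the one possibly solved for;
     it is free, hence nonzero. *)
  pose i : 'I_(m j).+1 := if idx_of (b k) j == ord0 then ord_max else ord0.
  exists i; rewrite mxE z_free //.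
  rewrite /solved row_var var_idxE !negb_and; do 2! (apply/orP; right).
  rewrite /i; case: ifP => [/eqP ->|/negbT]; last by rewrite eq_sym.
  by rewrite -val_eqE /= -lt0n m_gt0.
- move=> k.
  have Cv0 : (C k).@[v0] != 0.
    by have := denv0 (xk k); rewrite /den solved_xk row_var.
  have zxk : z (xk k) = - (S k).@[v0] / (C k).@[v0].
    by rewrite /z /num /den solved_xk row_var mevalN.
  rewrite (bigID (sel k)) /=.
  have -> : \sum_(a | sel k a) 'X_[w a].@[v0] *
      segre_vec (fun j => \row_i z (var_idx k i)) 0 a = z (xk k) * (C k).@[v0].
    rewrite /C raddf_sum mulr_sumr; apply: eq_bigr => a sela /=.
    rewrite mpolyXD mevalM mulrCA; congr (_ * _).
    rewrite !mxE (bigD1 (jj k)) //= mxE (eqP sela); congr (_ * _).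
    rewrite /cof mpolyX_sum rmorph_prod; apply: eq_bigr => j jk /=.
    by rewrite mevalXU mxE z_free // solved_var (negbTE jk).
  have -> : \sum_(a | ~~ sel k a) 'X_[w a].@[v0] *
      segre_vec (fun j => \row_i z (var_idx k i)) 0 a = (S k).@[v0].
    rewrite /S raddf_sum; apply: eq_bigr => a sela /=.
    rewrite mpolyXD mevalM; congr (_ * _).
    rewrite !mxE /entry_mnm mpolyX_sum rmorph_prod; apply: eq_bigr => j _ /=.
    rewrite mevalXU mxE z_free // solved_var; apply: contra sela.
    by move=> /andP[/eqP -> e].
  by rewrite zxk divfK // addNr.
- have -> : eval_coords f (fun k j => \row_i z (var_idx k i)) = f.@[z].
    apply: meval_eq => i; case E : (enum_val i) => [k [j t]] /=.
    by rewrite mxE /var_idx -[Tagged _ _]/(existT _ j t) -E enum_valK.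
  move: Fv0; rewrite meval_subst_num // mulf_eq0 negb_or.
  by case/andP.
Qed.

End Parametrization.

(** * Evaluating the vanishing ideal on hyperplane configurations *)

Section Vanishing.

Variables (K : fieldType) (n r : nat) (m : 'I_r -> nat).
Local Notation d := (Mseg m).+1.

(** Rank-nullity: a nonzero linear form has an image of dimension one. *)
Lemma dim_kernel_functional (u : 'cV[K]_d) : u != 0 ->
  \dim (lker (linfun (mulmxr u : 'rV[K]_d -> 'M[K]_1))) = Mseg m.
Proof.
move=> /cV0Pn[a ua]; set phi := linfun _.
have := limg_ker_dim phi fullv; rewrite capfv dimvf dim_matrix mul1r.
suff -> : \dim (phi @: fullv) = 1%N by rewrite addn1 => -[].
apply/eqP; rewrite eqn_leq; apply/andP; split.
  by apply: leq_trans (dimvS (subvf _)) _; rewrite dimvf dim_matrix.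
rewrite lt0n dimv_eq0; apply: contraNneq ua => phi0.
have : phi (delta_mx 0 a) \in (phi @: fullv)%VS by rewrite memv_img ?memvf.
rewrite phi0 memv0 lfunE /= -rowE => /eqP /matrixP /(_ 0 0).
by rewrite !mxE => ->.
Qed.

(** The lines spanned by the [v k j] form a configuration on the hyperplane with normal [u], hence a
    point of [Seg]. *)
Lemma vanishing_ideal_eval (f : {mpoly K[nvars n m]}) (u : 'I_d -> K)
    (v : 'I_n -> forall j : 'I_r, 'rV[K]_(m j).+1) :
  vanishing_ideal (@Seg K n r m) f -> (forall a, u a != 0) ->
  (forall k j, v k j != 0) -> (forall k, \sum_a u a * segre_vec (v k) 0 a = 0) ->
  eval_coords f v = 0.
Proof.
move=> If u0 v0 uv.
have dim1 k j : \dim <[v k j]>%VS == 1%N by rewrite dim_vline v0.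
pose P : 'I_n -> mproj K m := fun k j => exist _ <[v k j]>%VS (dim1 k j).
have vP k j : has_coords (P k j) (v k j) by [].
apply: in_ideal_meval0 If => g [_]; apply=> // Z _; apply.
pose u' : 'cV[K]_d := \col_a u a.
exists (lker (linfun (mulmxr u' : 'rV[K]_d -> 'M[K]_1))); split.
  by apply: dim_kernel_functional; apply/cV0Pn; exists ord0; rewrite mxE.
move=> k; rewrite (segreE (vP k)) -memvE memv_ker lfunE /=.
apply/eqP/matrixP => i j; rewrite !ord1 !mxE -[RHS](uv k).
by apply: eq_bigr => a _; rewrite !mxE mulrC.
Qed.

End Vanishing.

(** * Comparison of initial ideals *)

Lemma minor_lead_divides (K : numFieldType) (n r : nat) (m : 'I_r -> nat)
    (hm : forall j : 'I_r, (1 <= m j)%N) (le : rel 'X_{1..nvars n m})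
    (f : {mpoly K[nvars n m]}) (mu : 'X_{1..nvars n m}) :
  monomial_order le -> vanishing_ideal (@Seg K n r m) f ->
  is_lead_monomial le f mu ->
  exists g a, [/\ g \in maximal_minors K n m, is_lead_monomial le g a & (a <= mu)%MM].
Proof.
move=> le_mon If f_mu.
case: (dichotomy le_mon (@entry_mnm n r m)
  (fun a => [set k | (entry_mnm k a <= mu)%MM])) => [[kap kap_mu dom]|[w w_bal]].
  have [g gG g_lead] := minor_lead K le_mon dom.
  exists g, (\sum_a entry_mnm (kap a) a)%MM; split=> //.
  apply: entry_mnm_sum_le; first exact: dominating_inj dom.
  by move=> a; have := kap_mu a; rewrite inE.
have [u [v [u0 v0 uv]]] := hyperplane_witness hm le_mon f_mu w_bal.
by rewrite (vanishing_ideal_eval If u0 v0 uv) eqxx.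
Qed.

Theorem theorem3p9 (R : realType) (r : nat) (hr : (1 <= r)%N)
    (m : 'I_r -> nat) (hm : forall j : 'I_r, (1 <= m j)%N)
    (n : nat) (hn : (Mseg m < n)%N) :
  universal_groebner_basis
    (vanishing_ideal (@Seg R[i] n r m))
    (maximal_minors R[i] n m).
Proof.
move=> le le_mon; split=> [g|u]; first exact: minor_in_ideal.
split; apply: in_ideal_trans => _ [f [a [If f_a ->]]].
  by apply: in_ideal_gen; exists f, a; split=> //; exact: minor_in_ideal.
(* The generator with exponent [a] is a monomial multiple of the leading monomial [b] of a minor. *)
have [g [b [gG g_b ba]]] := minor_lead_divides hm le_mon If f_a.
rewrite -(submK ba) mpolyXD; apply/in_idealMl/in_ideal_gen.
by exists g, b.
Qed.
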